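(* Let $\Lambda$ be a set and let $\Gamma$ be a subshift of $\Lambda^\omega$. If $\Gamma$ is a subshift of bounded type, then $(\Gamma,\sigma)$ has the asymptotic shadowing property.
   Context: Let $\omega=\{0,1,2,\dots\}$. $\Lambda$ is an arbitrary (possibly infinite) set. $\Lambda^\omega$ is the set of infinite sequences $x=x_0x_1x_2\cdots$ over $\Lambda$, with the product topology where $\Lambda$ is discrete, metrized by $d(x,y)=\inf\{2^{-n}: x_i=y_i \text{ for all } i<n\}$; the shift map is $\sigma(x_0x_1x_2\cdots)=x_1x_2\cdots$. A subshift of $\Lambda^\omega$ is a closed set $\Gamma\subseteq\Lambda^\omega$ with $\sigma(\Gamma)=\Gamma$. A word is a finite sequence over $\Lambda$ of length at least $1$; it is allowed for $\Gamma$ if it occurs as a block of consecutive symbols (subword) of some $x\in\Gamma$, and forbidden otherwise. A basis for the forbidden words of $\Gamma$ is a set $\mathcal F$ of forbidden words such that every forbidden word contains some element of $\mathcal F$ as a subword. $\Gamma$ is a subshift of bounded type (SBT) if it has a basis for its forbidden words whose elements have uniformly bounded length. For a map $f:X\to X$ on a metric space, an asymptotic pseudo-orbit is a sequence $\langle x_i\rangle_{i\in\omega}$ in $X$ with $d(f(x_i),x_{i+1})\to0$ as $i\to\infty$. $(X,f)$ has the asymptotic shadowing property if for every asymptotic pseudo-orbit $\langle x_i\rangle$ there is $z\in X$ with $d(f^i(z),x_i)\to0$ as $i\to\infty$. *)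

(* Defs.v *)
From HB Require Import structures.
From mathcomp Require Import all_boot all_order all_algebra.
From mathcomp Require Import all_classical all_reals all_analysis.

Set Implicit Arguments.
Unset Strict Implicit.
Unset Printing Implicit Defensive.

Import Order.TTheory GRing.Theory Num.Theory.
Import numFieldNormedType.Exports.
Local Open Scope classical_set_scope.
Local Open Scope ring_scope.

(* [{classic L}] is [L] with the eqType/choiceType structures given by classical
   logic, so the alphabet [L] may be any type (empty or infinite included). *)
Definition seq_space (L : Type) : Type :=
  prod_topology (fun _ : nat => discrete_topology {classic L}).

HB.instance Definition _ (L : Type) := Topological.copy (seq_space L)
  (prod_topology (fun _ : nat => discrete_topology {classic L})).

Section Shift.
Variable L : Type.
Implicit Types (x y : seq_space L) (G : set (seq_space L)).
Implicit Types (u w : seq {classic L}) (F : set (seq {classic L})).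

Definition shift_map x : seq_space L := fun i => x i.+1.

Definition seq_dist (R : realType) x y : R :=
  inf [set 2 ^- n | n in [set n : nat | forall i, (i < n)%N -> x i = y i]].

Definition subshift G := closed G /\ shift_map @` G = G.

Definition occurs_in w x := exists k, w = mkseq (fun i => x (k + i)%N) (size w).

Definition word w := (0 < size w)%N.

Definition allowed G w := word w /\ exists2 x, G x & occurs_in w x.

Definition forbidden G w := word w /\ ~ allowed G w.

Definition forbidden_basis G F :=
  F `<=` forbidden G /\
  forall w, forbidden G w -> exists2 u, F u & infix u w.

Definition bounded_type G :=
  exists2 F, forbidden_basis G F &
    exists N : nat, forall u, F u -> (size u <= N)%N.

End Shift.

(* The metric space is the subset [A] of [X] with the distance [d]; the
   definitions are meant for [f] mapping [A] into [A]. *)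
Section Shadowing.
Variables (R : realType) (X : Type) (d : X -> X -> R) (A : set X) (f : X -> X).

Definition asymptotic_pseudo_orbit (x : nat -> X) :=
  (forall i, A (x i)) /\ d (f (x i)) (x i.+1) @[i --> \oo] --> (0 : R).

Definition asymptotic_shadowing :=
  forall x, asymptotic_pseudo_orbit x ->
    exists2 z, A z & d (iter i f z) (x i) @[i --> \oo] --> (0 : R).

End Shadowing.

(* Main.v *)
Require Import Defs.
From mathcomp Require Import all_boot all_order all_algebra.
From mathcomp Require Import all_classical all_reals all_analysis.

Import Order.TTheory GRing.Theory Num.Theory.
Import numFieldNormedType.Exports.
Local Open Scope classical_set_scope.
Local Open Scope ring_scope.

(* Read off the diagonal [y i := x i 0] of the pseudo-orbit.  Since consecutive
   errors tend to [0], for every [n] the first [n] symbols of [shift^i y] are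
   eventually those of [x i].  Taking [n] to be the bound on the lengths of the
   basic forbidden words, some tail of [y] contains no basic forbidden word,
   hence no forbidden word, and closedness puts this tail in [Gamma].
   Surjectivity of the shift lifts it to the required [z]. *)

Definition agree {L : Type} (n : nat) (x y : seq_space L) : Prop :=
  forall i, (i < n)%N -> x i = y i.

Lemma seq_dist_ge0 (R : realType) (L : Type) (x y : seq_space L) :
  0 <= seq_dist R x y.
Proof.
apply: lb_le_inf; first by exists (2 ^- 0), 0%N.
by move=> _ [n _ <-]; rewrite invr_ge0 exprn_ge0.
Qed.

Lemma agree_seq_dist_le (R : realType) (L : Type) (n : nat)
    (x y : seq_space L) : agree n x y -> seq_dist R x y <= 2 ^- n.
Proof.
move=> xy; apply: ge_inf; last by exists n.
by exists 0 => _ [m _ <-]; rewrite invr_ge0 exprn_ge0.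
Qed.

Lemma seq_dist_lt_agree (R : realType) (L : Type) (n : nat)
    (x y : seq_space L) : seq_dist R x y < 2 ^- n -> agree n x y.
Proof.
move=> /inf_lt[|_ [m xy <-]]; first by exists (2 ^- 0), 0%N.
rewrite ltf_pV2 ?posrE ?exprn_gt0// ltr_eXn2l ?ltr1n// => nm i ni.
exact: xy (ltn_trans ni nm).
Qed.

(** Distances below [2 ^- n] force [n] common symbols, and [n] common symbols bound the distance by
    [2 ^- n]. Both uses of the metric thus become combinatorial. *)
Lemma seq_dist_cvg0P (R : realType) (L : Type) (u v : nat -> seq_space L) :
  seq_dist R (u i) (v i) @[i --> \oo] --> (0 : R) <->
  forall n, \forall i \near \oo, agree n (u i) (v i).
Proof.
split=> [/cvgrPdist_lt uv n|uv].
  have /uv : 0 < (2 ^- n : R) by rewrite invr_gt0 exprn_gt0.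
  apply: filterS => i; rewrite sub0r normrN ger0_norm ?seq_dist_ge0//.
  exact: seq_dist_lt_agree.
apply/cvgrPdist_lt => e e0.
have /cvgrPdist_lt/(_ _ e0)[n _ /(_ n (leqnn n))] :
    (2^-1 : R) ^+ k @[k --> \oo] --> (0 : R).
  by apply: cvg_expr; rewrite ger0_norm ?invr_ge0// invf_lt1 ?ltr1n.
rewrite /= sub0r normrN ger0_norm ?exprn_ge0 ?invr_ge0// exprVn => ne.
apply: filterS (uv n) => i /(@agree_seq_dist_le R) uvi.
by rewrite sub0r normrN ger0_norm ?seq_dist_ge0//; exact: le_lt_trans ne.
Qed.

Lemma iter_shift_mapE (L : Type) (n : nat) (x : seq_space L) :
  iter n (@shift_map L) x = (fun i => x (n + i)%N).
Proof.
elim: n => [|n IHn] /=; first by [].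
by rewrite IHn; apply/funext => i; rewrite /shift_map addnS.
Qed.

Lemma subshift_iter (L : Type) (G : set (seq_space L)) (n : nat) x :
  subshift G -> G x -> G (iter n (@shift_map L) x).
Proof.
move=> [_ GE] Gx; elim: n => //= n IHn.
by rewrite -GE; exists (iter n (@shift_map L) x).
Qed.

Lemma subshift_iter_surj (L : Type) (G : set (seq_space L)) (n : nat) x :
  subshift G -> G x -> exists2 z, G z & iter n (@shift_map L) z = x.
Proof.
move=> [_ GE]; elim: n x => [|n IHn] x Gx; first by exists x.
move: Gx; rewrite -{1}GE => -[y /IHn[z Gz <-] <-].
by exists z.
Qed.

Lemma closed_agree (L : Type) (G : set (seq_space L)) (x : seq_space L) :
  closed G -> (forall n, exists2 y, G y & agree n x y) -> G x.
Proof.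
move=> Gcl xG.
have /choice[y yP] : forall n, exists y, G y /\ agree n x y.
  by move=> n; have [y] := xG n; exists y.
apply: (@closed_cvg _ _ \oo _ y) Gcl _ _ _.
  by apply: nearW => n; have [] := yP n.
(* The product topology is the supremum of those induced by the projections, so one coordinate [i]
   is treated at a time; there [y n] equals [x] once [n > i]. *)
apply/cvg_sup => i A [_ [[B _ <-] Bx]] BA.
apply: filterS (nbhs_infty_gt i) => n ni; apply: BA => /=.
by have [_ /(_ i ni)] := yP n; rewrite /proj => <-.
Qed.

(** If a prefix of [x] occurs at position [k] of a point of [G], the [k]-th shift of that point
    begins with it. Lengths [n.+1] are used because words are nonempty. *)
Lemma allowed_prefixes_mem (L : Type) (G : set (seq_space L)) x :
  subshift G -> (forall n, allowed G (mkseq x n.+1)) -> G x.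
Proof.
move=> GS xG; apply: closed_agree => [|n]; first by case: GS.
have [_ [y Gy [k]]] := xG n; rewrite size_mkseq => xy.
exists (iter k (@shift_map L) y); first exact: subshift_iter.
move=> i ni; rewrite iter_shift_mapE.
have ni1 : (i < n.+1)%N by rewrite ltnW.
by rewrite -(nth_mkseq (x 0%N) x ni1) xy nth_mkseq.
Qed.

Lemma bounded_basis_mem (L : Type) (G : set (seq_space L)) F (N : nat) x :
  subshift G -> forbidden_basis G F -> (forall u, F u -> (size u <= N)%N) ->
  (forall k, exists2 y, G y & agree N (iter k (@shift_map L) x) y) -> G x.
Proof.
move=> GS [FG GF] FN xG; apply: allowed_prefixes_mem => // n.
apply: contrapT => xnG.
have [] := GF (mkseq x n.+1); first by split=> //; rewrite /word size_mkseq.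
move=> u Fu /infixP[s [t xE]].
have [u0] := FG _ Fu; apply; split=> //.
(* [u] starts at position [size s] of [x] and fits in the window of length [N] there, so it is a
   prefix of [y] and hence allowed. *)
have [y Gy xy] := xG (size s); exists y => //; exists 0%N.
apply: (@eq_from_nth _ (x 0%N)) => [|i iu]; first by rewrite size_mkseq.
rewrite nth_mkseq// add0n -xy ?(leq_trans iu) ?FN// iter_shift_mapE.
have /(congr1 size) := xE; rewrite size_mkseq !size_cat => sz.
rewrite -(nth_mkseq (x 0%N) x (_ : size s + i < n.+1)%N).
  by rewrite xE nth_cat ltnNge leq_addr addKn nth_cat iu.
by rewrite sz ltn_add2l ltn_addr.
Qed.

Lemma pseudo_orbit_diagonal (L : Type) (x : nat -> seq_space L) (n : nat) :
  (\forall i \near \oo, agree n (shift_map (x i)) (x i.+1)) ->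
  \forall i \near \oo, agree n (fun j => x (i + j)%N 0%N) (x i).
Proof.
(* [i] stays general: [x (i + j.+1) 0 = x i.+1 j] by induction at [i.+1], and this is [x i j.+1] by
   the pseudo-orbit agreement. *)
move=> [I _ xI]; exists I => // i /= Ii j; elim: j i Ii => [|j IHj] i Ii jn.
  by rewrite addn0.
rewrite addnS -addSn IHj ?(ltnW jn)// ?(leq_trans Ii)//.
by rewrite -(xI i Ii j (ltnW jn)).
Qed.

Theorem corollary13 (R : realType) (Lambda : Type)
    (Gamma : set (seq_space Lambda)) (hGamma : subshift Gamma) :
  bounded_type Gamma ->
  asymptotic_shadowing (@seq_dist Lambda R) Gamma (@shift_map Lambda).
Proof.
move=> [F FG [N FN]] x [Gx /seq_dist_cvg0P xorb].
pose y : seq_space Lambda := fun i => x i 0%N.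
have yx n : \forall i \near \oo, agree n (iter i (@shift_map Lambda) y) (x i).
  apply: filterS (pseudo_orbit_diagonal _ _ _ (xorb n)) => i.
  by rewrite iter_shift_mapE.
have [I _ yI] := yx N.
have Gy : Gamma (iter I (@shift_map Lambda) y).
  apply: (bounded_basis_mem _ _ _ N _ hGamma FG FN) => k.
  (* The pseudo-orbit itself supplies the points of [Gamma] that match the windows of length [N]. *)
  exists (x (k + I)%N) => //; rewrite -iterD.
  exact/yI/leq_addl.
have [z Gz zy] := subshift_iter_surj _ _ I _ hGamma Gy.
exists z => //; apply/seq_dist_cvg0P => n.
have := yx n; apply: filterS2 (nbhs_infty_ge I) => i Ii.
(* From time [I] on, the orbits of [z] and [y] coincide. *)
by rewrite -(subnK Ii) !iterD zy.
Qed.
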